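(* Let $-1<p\leq 0$. Then the following inequalities hold for all $x\in\mathbb{R}$: $$\mathcal{I}_{p+1}(x)\leq\frac{1+(p+1)\mathcal{I}_p(x)}{p+2},$$ $$\frac{\mathcal{I}_{p+1}(x)}{\mathcal{I}_p(x)}+\frac{(p+2)\mathcal{I}_p(x)}{1+(p+1)\mathcal{I}_p(x)}\geq 2,$$ $$\frac{\tanh x}{x}+\frac{3\cosh x}{2+\cosh x}\geq 2,$$ where $\frac{\tanh x}{x}$ is interpreted as $1$ at $x=0$.
   Context: For $q>-1$, $I_q(x)=\sum_{n\geq 0}\frac{(x/2)^{q+2n}}{n!\,\Gamma(q+n+1)}$ (for $x>0$) is the modified Bessel function of the first kind of order $q$. The normalized function $\mathcal{I}_q:\mathbb{R}\to[1,\infty)$ is defined by $$\mathcal{I}_q(x)=2^q\Gamma(q+1)x^{-q}I_q(x)=\sum_{n\geq 0}\frac{(1/4)^n}{(q+1)_n\, n!}x^{2n},$$ where $(q+1)_n=\Gamma(q+n+1)/\Gamma(q+1)$ is the Pochhammer symbol (the power series defines $\mathcal{I}_q$ for all real $x$, including $x=0$). *)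

(* Defs.v *)
From Stdlib Require Import Reals Factorial Lra.
From Coquelicot Require Import Coquelicot.
Open Scope R_scope.

(* Euler's integral of the second kind; convergent, hence meaningful, for s > 0. *)
Definition Gamma (s : R) : R :=
  RInt_gen (fun t => Rpower t (s - 1) * exp (- t))
    (at_right 0) (Rbar_locally p_infty).

Definition pochhammer (a : R) (n : nat) : R := Gamma (a + INR n) / Gamma a.

(* Meaningful for x > 0 and q > -1 only, since [Rpower] is. *)
Definition besselI (q x : R) : R :=
  Series (fun n => Rpower (x / 2) (q + 2 * INR n)
                   / (INR (fact n) * Gamma (q + INR n + 1))).

(* The power series is taken as the definition so that x ranges over all of R;
   [normI_besselI] gives the other expression, valid for x > 0. *)
Definition normI (q x : R) : R :=
  Series (fun n => (1 / 4) ^ n / (pochhammer (q + 1) n * INR (fact n))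
                   * x ^ (2 * n)).

Lemma normI_besselI (q x : R) : 0 < x ->
  normI q x = Rpower 2 q * Gamma (q + 1) * Rpower x (- q) * besselI q x.
Proof.
intros Hx; unfold normI, besselI; rewrite <- Series_scal_l.
apply Series_ext; intros n; unfold pochhammer.
replace (q + 1 + INR n) with (q + INR n + 1) by ring.
assert (E : Rpower 2 q * Rpower x (- q) * Rpower (x / 2) (q + 2 * INR n)
            = (1 / 4) ^ n * x ^ (2 * n)).
{ rewrite Rpower_plus.
  replace (2 * INR n) with (INR (2 * n)) by (rewrite mult_INR; simpl; ring).
  rewrite (Rpower_pow (2 * n) (x / 2)) by lra.
  assert (H1 : Rpower 2 q * Rpower (x / 2) q = Rpower x q).
  { rewrite Rpower_mult_distr by lra; f_equal; field. }
  assert (H2 : Rpower x (- q) * Rpower x q = 1).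
  { rewrite <- Rpower_plus, Rplus_opp_l; apply Rpower_O; exact Hx. }
  transitivity ((Rpower x (- q) * (Rpower 2 q * Rpower (x / 2) q))
                * (x / 2) ^ (2 * n)); [ring|].
  rewrite H1, H2, Rmult_1_l, !pow_mult, <- Rpow_mult_distr.
  f_equal; field. }
unfold Rdiv at 1 2 4; unfold Rdiv in E |- *.
rewrite !Rinv_mult, Rinv_inv.
transitivity (((1 * / 4) ^ n * x ^ (2 * n)) * / Gamma (q + INR n + 1)
              * Gamma (q + 1) * / INR (fact n)); [ring|].
rewrite <- E; ring.
Qed.

(* tanh x / x extended by continuity at 0. *)
Definition tanhc (x : R) : R := if Req_dec_T x 0 then 1 else tanh x / x.

(* Main.v *)
Require Import Defs.
From Stdlib Require Import Reals Factorial Lra Lia.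
From Coquelicot Require Import Coquelicot.
Open Scope R_scope.

(* By [Gamma (s + 1) = s Gamma s], the coefficients b_n of I_p in y = x ^ 2
   satisfy b_(n+1) = b_n / (4 (p + 1 + n) (n + 1)), and those of I_(p+1) are
   (p + 1) / (p + 1 + n) b_n; the first inequality then holds term by term.
   For the second, put u = I_(p+1), v = I_p and z = y / (4 (p + 2)), the linear
   term of u.  Clearing denominators it reads
   u + (p + 1) u v - p v ^ 2 >= 2 v, and it is a positive combination of
   u - 1 >= z, (u - 1) (v - 1) >= z (v - 1), - p (v - 1) ^ 2 >= 0 and
   (p + 1) (v - 1) <= (p + 2) z + (p + 1) z (v - 1), the last one being again a
   comparison of coefficients.  The third inequality is the case p = - 1/2. *)

(** * Improper integrals over the positive half-line *)

Lemma continuous_ex_RInt_pos (f : R -> R) (a b : R) :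
  (forall t, 0 < t -> continuous f t) -> 0 < a -> 0 < b -> ex_RInt f a b.
Proof.
intros Cf Ha Hb; apply (ex_RInt_continuous (V := R_CompleteNormedModule)).
intros t Ht; apply Cf.
apply Rlt_le_trans with (2 := proj1 Ht); now apply Rmin_glb_lt.
Qed.

(** Positivity makes the integral grow with the interval, so the limit is the supremum over compact
    subintervals: once some [[a, b]] comes within [eps] of it, so does every larger interval. *)
Lemma is_RInt_gen_pos_bounded (f : R -> R) (M : R) :
  (forall t, 0 < t -> continuous f t) ->
  (forall t, 0 < t -> 0 < f t) ->
  (forall a b, 0 < a -> a <= b -> RInt f a b <= M) ->
  exists l, 0 < l
    /\ is_RInt_gen f (at_right 0) (Rbar_locally p_infty) l.
Proof.
intros Cf Pf Bf.
assert (Ef := fun a b => continuous_ex_RInt_pos f a b Cf).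
set (E := fun z => exists a b, 0 < a /\ a <= b /\ z = RInt f a b).
destruct (completeness E) as [l [Ub Lb]].
{ exists M; intros z (a & b & Ha & Hab & ->); now apply Bf. }
{ exists (RInt f 1 2), 1, 2; repeat split; lra. }
assert (Mono : forall a b c d, 0 < a -> a <= b -> b <= c -> c <= d ->
          RInt f b c <= RInt f a d).
{ intros a b c d Ha Hab Hbc Hcd.
  rewrite <- (RInt_Chasles f a b d), <- (RInt_Chasles f b c d);
    try (apply Ef; lra).
  unfold plus; simpl.
  assert (N : forall u v, 0 < u -> u <= v -> 0 <= RInt f u v).
  { intros u v Hu Huv; apply RInt_ge_0; try (apply Ef; lra); trivial.
    intros t Ht; apply Rlt_le, Pf; lra. }
  assert (0 <= RInt f a b) by (apply N; lra).
  assert (0 <= RInt f c d) by (apply N; lra).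
  lra. }
exists l; split.
{ apply Rlt_le_trans with (RInt f 1 2).
  - apply RInt_gt_0; [lra| |]; intros t Ht; [apply Pf|apply Cf]; lra.
  - apply Ub; exists 1, 2; repeat split; lra. }
intros P [eps HP].
destruct (Classical_Prop.classic
            (exists a b, 0 < a /\ a <= b /\ l - eps < RInt f a b))
  as [(a & b & Ha & Hab & Hl)|No].
2: { exfalso; enough (l <= l - eps) by (destruct eps; simpl in *; lra).
     apply Lb; intros z (a & b & Ha & Hab & ->).
     apply Rnot_lt_le; intros H; apply No; now exists a, b. }
apply (Filter_prod _ _ _ (fun u => 0 < u < a) (fun v => b < v)).
- exists (mkposreal a Ha); intros u Hu Hu0.
  unfold ball in Hu; simpl in Hu; unfold AbsRing_ball, abs, minus, plus, opp in Hu;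
    simpl in Hu.
  apply Rabs_def2 in Hu; lra.
- now exists b.
- intros u v [Hu Hua] Hv; simpl.
  exists (RInt f u v); split.
  + apply (RInt_correct (V := R_CompleteNormedModule)), Ef; lra.
  + apply HP; unfold ball; simpl; unfold AbsRing_ball, abs, minus, plus, opp; simpl.
    assert (RInt f a b <= RInt f u v) by (apply Mono; lra).
    assert (RInt f u v <= l) by (apply Ub; exists u, v; repeat split; lra).
    destruct eps; simpl in *; apply Rabs_def1; lra.
Qed.

Lemma is_RInt_gen_derive_pos (f df : R -> R) (la lb : R) :
  (forall t, 0 < t -> is_derive f t (df t)) ->
  (forall t, 0 < t -> continuous df t) ->
  filterlim f (at_right 0) (locally la) ->
  filterlim f (Rbar_locally p_infty) (locally lb) ->
  is_RInt_gen df (at_right 0) (Rbar_locally p_infty) (lb - la).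
Proof.
intros Df Cdf La Lb.
(* Both endpoints are eventually positive, hence so is everything between them; this turns facts on
   the half-line into the filter form needed for the fundamental theorem. *)
assert (Pos : forall P : R -> Prop, (forall t, 0 < t -> P t) ->
  filter_prod (at_right 0) (Rbar_locally p_infty)
    (fun ab => forall t, Rmin (fst ab) (snd ab) <= t <= Rmax (fst ab) (snd ab) ->
                         P t)).
{ intros P HP.
  apply (Filter_prod _ _ _ (fun u => 0 < u) (fun v => 0 < v)).
  - exists (mkposreal 1 Rlt_0_1); now intros u _ Hu.
  - now exists 0.
  - intros u v Hu Hv t [Ht _]; apply HP.
    apply Rlt_le_trans with (2 := Ht); now apply Rmin_glb_lt. }
apply is_RInt_gen_ext with (Derive f).
{ refine (filter_imp _ _ _ (Pos (fun t => Derive f t = df t) _)).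
  - intros ab H t Ht; apply H; lra.
  - intros t Ht; now apply is_derive_unique, Df. }
apply is_RInt_gen_Derive; trivial; apply Pos; intros t Ht.
- now exists (df t); apply Df.
- apply continuous_ext_loc with df; [|now apply Cdf].
  exists (mkposreal t Ht); intros u Hu.
  unfold ball in Hu; simpl in Hu; unfold AbsRing_ball, abs, minus, plus, opp in Hu;
    simpl in Hu.
  apply Rabs_def2 in Hu.
  symmetry; apply is_derive_unique, Df; lra.
Qed.

(** * The Gamma function: convergence, positivity, functional equation *)

(** The concave [k * ln t] lies below its tangent at [t = k]. This quantifies how [exp (- t)] beats
    powers of [t]. *)
Lemma ln_le_linear (k t : R) : 0 < k -> 0 < t -> k * ln t <= t - k + k * ln k.
Proof.
intros Hk Ht.
assert (H := exp_ineq1_le (ln (t / k))).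
rewrite exp_ln in H by now apply Rdiv_lt_0_compat.
unfold Rdiv in H; rewrite ln_mult, ln_Rinv in H;
  [|lra|lra|now apply Rinv_0_lt_compat].
apply (Rmult_le_compat_l k) in H; [|lra].
replace (k * (t * / k)) with t in H by (field; lra); lra.
Qed.

Lemma gamma_integrand_continuous (s t : R) : 0 < t ->
  continuous (fun t => Rpower t (s - 1) * exp (- t)) t.
Proof.
intros Ht; apply (ex_derive_continuous (V := R_NormedModule)).
unfold Rpower; auto_derive; lra.
Qed.

(* [(t / (1 + t)) ^ s] has derivative [s t ^ (s - 1) (1 + t) ^ (- s - 1)], which
   dominates the integrand up to a constant both near [0] and near infinity. *)
Lemma gamma_integral_bounded (s : R) : 0 < s ->
  exists M, forall a b, 0 < a -> a <= b ->
    RInt (fun t => Rpower t (s - 1) * exp (- t)) a b <= M.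
Proof.
intros Hs.
(* [s * K] is the maximum of [(1 + t) ^ (s + 1) * exp (- t)], reached at [t = s]. *)
set (K := exp ((s + 1) * ln (s + 1) - s) / s).
assert (HK : 0 < K) by (apply Rdiv_lt_0_compat; [apply exp_pos|lra]).
exists K; intros a b Ha Hab.
set (H := fun t => K * exp (s * (ln t - ln (1 + t)))).
set (dH := fun t => K * (s * (/ t - / (1 + t)) * exp (s * (ln t - ln (1 + t))))).
assert (I : is_RInt dH a b (minus (H b) (H a))).
{ apply (is_RInt_derive (V := R_CompleteNormedModule));
    rewrite Rmin_left by lra; intros t Ht.
  - unfold H, dH, Rminus; auto_derive; [lra|field; lra].
  - apply (ex_derive_continuous (V := R_NormedModule)).
    unfold dH; auto_derive; lra. }
apply Rle_trans with (RInt dH a b).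
- apply RInt_le; trivial.
  + apply continuous_ex_RInt_pos; try lra; intros; now apply gamma_integrand_continuous.
  + now exists (minus (H b) (H a)).
  + intros t Ht; unfold dH.
    assert (L := ln_le_linear (s + 1) (1 + t) ltac:(lra) ltac:(lra)).
    assert (Eq : K * (s * (/ t - / (1 + t)) * exp (s * (ln t - ln (1 + t))))
              = exp (((s + 1) * ln (s + 1) - s)
                     + (- ln t + - ln (1 + t) + s * (ln t - ln (1 + t))))).
    { rewrite !exp_plus, !exp_Ropp, !exp_ln by lra; unfold K; field; lra. }
    rewrite Eq; unfold Rpower; rewrite <- exp_plus.
    assert (X : forall u v, u <= v -> exp u <= exp v).
    { intros u v [Huv| ->]; [now apply Rlt_le, exp_increasing|lra]. }
    apply X; lra.
- rewrite (is_RInt_unique _ _ _ _ I); unfold H.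
  assert (E : exp (s * (ln b - ln (1 + b))) < 1).
  { apply Rlt_le_trans with (exp 0); [apply exp_increasing|rewrite exp_0; lra].
    assert (ln b < ln (1 + b)) by (apply ln_increasing; lra).
    assert (0 < s * (ln (1 + b) - ln b)) by (apply Rmult_lt_0_compat; lra).
    lra. }
  assert (0 < exp (s * (ln a - ln (1 + a)))) by apply exp_pos.
  unfold minus, plus, opp; simpl; nra.
Qed.

Lemma Gamma_unique (s l : R) :
  is_RInt_gen (fun t => Rpower t (s - 1) * exp (- t))
    (at_right 0) (Rbar_locally p_infty) l ->
  Gamma s = l.
Proof.
intros I; unfold Gamma.
exact (is_RInt_gen_unique (V := R_CompleteNormedModule) (Fa := at_right 0)
         (Fb := Rbar_locally p_infty) _ _ I).
Qed.

Lemma Gamma_correct (s : R) : 0 < s ->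
  0 < Gamma s
  /\ is_RInt_gen (fun t => Rpower t (s - 1) * exp (- t))
       (at_right 0) (Rbar_locally p_infty) (Gamma s).
Proof.
intros Hs; destruct (gamma_integral_bounded s Hs) as [M HM].
destruct (is_RInt_gen_pos_bounded (fun t => Rpower t (s - 1) * exp (- t)) M)
  as (l & Hl & Il); trivial.
- intros; now apply gamma_integrand_continuous.
- intros; apply Rmult_lt_0_compat; apply exp_pos.
- replace (Gamma s) with l; [now split|].
  symmetry; now apply Gamma_unique.
Qed.

(** Integration by parts: [exp (h t)] is [t ^ s * exp (- t)], which vanishes at both ends, so its
    derivative has integral 0; subtracting that derivative from [s] times the integrand at [s]
    leaves the integrand at [s + 1]. *)
Lemma Gamma_succ (s : R) : 0 < s -> Gamma (s + 1) = s * Gamma s.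
Proof.
intros Hs.
destruct (Gamma_correct s Hs) as [_ I0].
set (h := fun t => s * ln t - t).
assert (L0 : filterlim (fun t => exp (h t)) (at_right 0) (locally 0)).
{ apply filterlim_comp with (2 := is_lim_exp_m).
  apply filterlim_le_m_infty with (fun t => s * ln t).
  - exists (mkposreal 1 Rlt_0_1); intros t _ Ht; unfold h; lra.
  - apply filterlim_comp with (1 := is_lim_ln_0).
    intros P [N HN]; exists (N / s); intros y Hy; apply HN.
    apply (Rmult_lt_compat_l s) in Hy; trivial.
    now replace (s * (N / s)) with N in Hy by (field; lra). }
assert (L1 : filterlim (fun t => exp (h t)) (Rbar_locally p_infty) (locally 0)).
{ apply filterlim_comp with (2 := is_lim_exp_m).
  (* The tangent bound with slope parameter [s + 1] leaves a spare [ln t]: [h t <= k - ln t]. *)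
  set (k := (s + 1) * ln (s + 1) - (s + 1)).
  apply filterlim_le_m_infty with (fun t => k - ln t).
  - exists 0; intros t Ht; unfold h, k.
    assert (L := ln_le_linear (s + 1) t ltac:(lra) Ht); lra.
  - apply filterlim_comp with (1 := is_lim_ln_p).
    intros P [N HN]; exists (k - N); intros y Hy; apply HN; lra. }
assert (I : is_RInt_gen (fun t => (s / t - 1) * exp (h t))
              (at_right 0) (Rbar_locally p_infty) (0 - 0)).
{ apply is_RInt_gen_derive_pos with (fun t => exp (h t)); trivial; intros t Ht.
  - unfold h, Rminus; auto_derive; [lra|field; lra].
  - apply (ex_derive_continuous (V := R_NormedModule)).
    unfold h; auto_derive; lra. }
apply (is_RInt_gen_scal _ s) in I0.
assert (J := is_RInt_gen_minus _ _ _ _ I0 I).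
rewrite (Gamma_unique (s + 1) (s * Gamma s - (0 - 0))); [ring|].
refine (is_RInt_gen_ext _ _ _ _ J).
apply (Filter_prod _ _ _ (fun u => 0 < u) (fun v => 0 < v)).
- exists (mkposreal 1 Rlt_0_1); now intros u _ Hu.
- now exists 0.
- intros u v Hu Hv t [Ht _]; simpl in Ht.
  assert (T : 0 < t) by (apply Rlt_trans with (2 := Ht); now apply Rmin_glb_lt).
  unfold minus, scal, plus, opp; simpl; unfold mult; simpl.
  unfold h, Rpower, Rminus; rewrite !exp_plus.
  replace (s + 1 + - (1)) with s by ring.
  replace ((s + - (1)) * ln t) with (s * ln t + - ln t) by ring.
  rewrite !exp_plus, exp_Ropp, exp_ln by trivial; field; lra.
Qed.

(** * Coefficients of the normalized Bessel series *)

(** The coefficient of [y ^ n] for order [a - 1], given by its ratio recurrence so that later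
    comparisons avoid Gamma. In the second branch [INR n] is [INR m + 1]. *)
Fixpoint bcoef (a : R) (n : nat) : R :=
  match n with
  | O => 1
  | S m => bcoef a m / (4 * (a + INR m) * INR n)
  end.

Lemma bcoef_S (a : R) (n : nat) :
  bcoef a (S n) = bcoef a n / (4 * (a + INR n) * INR (S n)).
Proof. reflexivity. Qed.

Lemma bcoef_pos (a : R) (n : nat) : 0 < a -> 0 < bcoef a n.
Proof.
intros Ha; induction n as [|n IH]; [simpl; lra|rewrite bcoef_S].
assert (0 <= INR n) by apply pos_INR.
assert (0 < INR (S n)) by (apply lt_0_INR; lia).
apply Rdiv_lt_0_compat; [easy|]; apply Rmult_lt_0_compat; lra.
Qed.

Lemma bcoef_pochhammer (a : R) (n : nat) : 0 < a ->
  (1 / 4) ^ n / (pochhammer a n * INR (fact n)) = bcoef a n.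
Proof.
intros Ha.
assert (Ga := proj1 (Gamma_correct a Ha)).
induction n as [|n IH].
- unfold pochhammer; simpl; rewrite Rplus_0_r; field; lra.
- rewrite bcoef_S, <- IH; unfold pochhammer.
  assert (Hn : 0 < a + INR n) by (assert (0 <= INR n) by apply pos_INR; lra).
  assert (Gn := proj1 (Gamma_correct _ Hn)).
  assert (0 < INR (S n)) by (apply lt_0_INR; lia).
  assert (0 < INR (fact n)) by apply INR_fact_lt_0.
  replace (a + INR (S n)) with (a + INR n + 1) by (rewrite S_INR; ring).
  rewrite Gamma_succ, fact_simpl, mult_INR by trivial.
  rewrite <- tech_pow_Rmult; field; repeat split; lra.
Qed.

(** In Pochhammer terms, [(a + 1)_n = (a)_n (a + n) / a]. *)
Lemma bcoef_succ (a : R) (n : nat) : 0 < a ->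
  bcoef (a + 1) n = a / (a + INR n) * bcoef a n.
Proof.
intros Ha; induction n as [|n IH]; [simpl; field; lra|].
rewrite !bcoef_S, IH, S_INR.
assert (0 <= INR n) by apply pos_INR.
field; repeat split; lra.
Qed.

Lemma bcoef_le_fact (a : R) (n : nat) : 0 < a ->
  bcoef a n <= (1 + / a) * / INR (fact n).
Proof.
intros Ha; assert (Ia := Rinv_0_lt_compat a Ha).
(* For small [a] the factor [4 * (a + m)] is sure to be at least 1 only from [m = 1] on; the
   constant [1 + / a] absorbs the first two coefficients. *)
induction n as [|[|n] IH].
- simpl; lra.
- simpl; rewrite Rplus_0_r, Rmult_1_r.
  unfold Rdiv; rewrite Rinv_mult; lra.
- rewrite bcoef_S, fact_simpl, mult_INR.
  set (m := S n) in *.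
  assert (1 <= INR m) by (apply (le_INR 1); unfold m; lia).
  assert (0 < INR (S m)) by (apply lt_0_INR; lia).
  assert (0 < bcoef a m) by now apply bcoef_pos.
  apply Rle_trans with (bcoef a m / INR (S m)).
  + apply Rmult_le_compat_l; [lra|].
    apply Rinv_le_contravar; [easy|nra].
  + rewrite Rinv_mult; unfold Rdiv.
    replace ((1 + / a) * (/ INR (S m) * / INR (fact m)))
      with ((1 + / a) * / INR (fact m) * / INR (S m)) by ring.
    apply Rmult_le_compat_r; [now apply Rlt_le, Rinv_0_lt_compat|easy].
Qed.

(** * Convergence and bounds for the series in [y] *)

Lemma ex_series_bcoef (a y : R) : 0 < a -> 0 <= y ->
  ex_series (fun n => bcoef a n * y ^ n).
Proof.
intros Ha Hy.
apply (ex_series_le (K := R_AbsRing) (V := R_CompleteNormedModule))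
  with (fun n => (1 + / a) * (/ INR (fact n) * y ^ n)).
- intros n; unfold norm; simpl; unfold abs; simpl.
  assert (0 <= y ^ n) by now apply pow_le.
  assert (0 < bcoef a n) by now apply bcoef_pos.
  rewrite Rabs_pos_eq by (apply Rmult_le_pos; lra).
  rewrite <- Rmult_assoc; apply Rmult_le_compat_r; trivial.
  now apply bcoef_le_fact.
- apply (ex_series_scal_l (K := R_AbsRing) (V := R_NormedModule) (1 + / a)
    (fun n => / INR (fact n) * y ^ n)).
  exists (exp y); apply is_pseries_R, is_exp_Reals.
Qed.

Lemma normI_bcoef (q x : R) : -1 < q ->
  normI q x = Series (fun n => bcoef (q + 1) n * (x ^ 2) ^ n).
Proof.
intros Hq; apply Series_ext; intros n.
now rewrite bcoef_pochhammer, <- pow_mult by lra.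
Qed.

Lemma bcoef_S_le (a c : R) (n : nat) : 0 < a -> 0 < c ->
  c <= (a + INR n) * INR (S n) -> bcoef a (S n) <= / (4 * c) * bcoef a n.
Proof.
intros Ha Hc Hn; rewrite bcoef_S; unfold Rdiv; rewrite Rmult_comm.
apply Rmult_le_compat_r; [now apply Rlt_le, bcoef_pos|].
apply Rinv_le_contravar; lra.
Qed.

Lemma ex_series_bcoef_S (a y : R) : 0 < a -> 0 <= y ->
  ex_series (fun n => bcoef a (S n) * y ^ n).
Proof.
intros Ha Hy.
apply (ex_series_le (K := R_AbsRing) (V := R_CompleteNormedModule))
  with (fun n => / (4 * a) * (bcoef a n * y ^ n)).
- intros n; change (Rabs (bcoef a (S n) * y ^ n) <= / (4 * a) * (bcoef a n * y ^ n)).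
  assert (0 <= y ^ n) by now apply pow_le.
  assert (0 < bcoef a (S n)) by now apply bcoef_pos.
  rewrite Rabs_pos_eq by (apply Rmult_le_pos; lra).
  rewrite <- Rmult_assoc; apply Rmult_le_compat_r; trivial.
  apply bcoef_S_le; trivial.
  assert (0 <= INR n) by apply pos_INR.
  rewrite S_INR; nra.
- apply (ex_series_scal_l (K := R_AbsRing) (V := R_NormedModule) (/ (4 * a))
    (fun n => bcoef a n * y ^ n)).
  now apply ex_series_bcoef.
Qed.

Lemma Series_bcoef_decomp (a y : R) : 0 < a -> 0 <= y ->
  Series (fun n => bcoef a n * y ^ n)
  = 1 + y * Series (fun n => bcoef a (S n) * y ^ n).
Proof.
intros Ha Hy; rewrite Series_incr_1 by now apply ex_series_bcoef.
rewrite <- Series_scal_l; simpl; f_equal; [ring|].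
apply Series_ext; intros n; simpl; ring.
Qed.

(** The linear coefficient is [/ (4 * a)], and from there on consecutive coefficients have ratio at
    most [/ (4 * (a + 1))]. *)
Lemma Series_bcoef_upper (a y : R) : 0 < a -> 0 <= y ->
  let v := Series (fun n => bcoef a n * y ^ n) in
  v - 1 <= y * (/ (4 * a) + / (4 * (a + 1)) * (v - 1)).
Proof.
intros Ha Hy v.
assert (Dv : v = 1 + y * Series (fun n => bcoef a (S n) * y ^ n))
  by now apply Series_bcoef_decomp.
set (w := Series (fun n => bcoef a (S n) * y ^ n)) in Dv.
assert (Ew := ex_series_bcoef_S a y Ha Hy).
(* Since [v - 1 = y * w], the claim is this bound times [y]; no division by [y] occurs, so [y = 0]
   is covered. *)
enough (w <= / (4 * a) + / (4 * (a + 1)) * y * w) by (rewrite Dv; nra).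
unfold w at 1; rewrite Series_incr_1 by trivial.
apply Rplus_le_compat; [simpl; right; field; lra|].
unfold w; rewrite <- Series_scal_l; apply Series_le.
- intros n.
  assert (0 <= y ^ S n) by now apply pow_le.
  split; [apply Rmult_le_pos; [now apply Rlt_le, bcoef_pos|easy]|].
  replace (/ (4 * (a + 1)) * y * (bcoef a (S n) * y ^ n))
    with (/ (4 * (a + 1)) * bcoef a (S n) * y ^ S n) by (simpl; ring).
  apply Rmult_le_compat_r; trivial.
  apply bcoef_S_le; try lra.
  assert (0 <= INR n) by apply pos_INR.
  rewrite !S_INR; nra.
- now apply (ex_series_scal_l (K := R_AbsRing) (V := R_NormedModule) (_ * y)
    (fun n => bcoef a (S n) * y ^ n)).
Qed.

Lemma Series_bcoef_lower (a y : R) : 0 < a -> 0 <= y ->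
  1 + / (4 * a) * y <= Series (fun n => bcoef a n * y ^ n).
Proof.
intros Ha Hy; rewrite Series_bcoef_decomp by trivial.
assert (Ew := ex_series_bcoef_S a y Ha Hy).
apply Rplus_le_compat_l; rewrite Rmult_comm; apply Rmult_le_compat_l; trivial.
rewrite Series_incr_1 by trivial.
replace (bcoef a 1 * y ^ 0) with (/ (4 * a)) by (simpl; field; lra).
set (r := fun n => bcoef a (S (S n)) * y ^ S n).
(* Nonnegativity of the tail is phrased as a comparison of two series. *)
enough (0 * Series r <= Series r) by lra.
rewrite <- Series_scal_l; apply Series_le.
- intros n; assert (0 <= r n) by
    (apply Rmult_le_pos; [now apply Rlt_le, bcoef_pos|now apply pow_le]).
  lra.
- now apply (ex_series_incr_1 (fun n => bcoef a (S n) * y ^ n)).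
Qed.

(** * The two inequalities for general order *)

Lemma normI_ge_1 (q x : R) : -1 < q -> 1 <= normI q x.
Proof.
intros Hq; rewrite normI_bcoef by trivial.
assert (Hy := pow2_ge_0 x).
assert (H := Series_bcoef_lower (q + 1) (x ^ 2) ltac:(lra) Hy).
assert (0 < / (4 * (q + 1))) by (apply Rinv_0_lt_compat; lra).
nra.
Qed.

(** Both constant terms are 1, so they are split off; in degree [n >= 1] the claim is
    [a / (a + n) <= a / (a + 1)] with [a = p + 1]. *)
Lemma normI_cusa (p x : R) : -1 < p ->
  normI (p + 1) x <= (1 + (p + 1) * normI p x) / (p + 2).
Proof.
intros Hp; rewrite !normI_bcoef by lra.
assert (Hy := pow2_ge_0 x).
set (a := p + 1); assert (Ha : 0 < a) by (unfold a; lra).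
rewrite !Series_bcoef_decomp by lra.
replace ((1 + a * (1 + x ^ 2 * Series (fun n => bcoef a (S n) * (x ^ 2) ^ n))) / (p + 2))
  with (1 + x ^ 2 * (a / (a + 1)
              * Series (fun n => bcoef a (S n) * (x ^ 2) ^ n)))
  by (unfold a; field; lra).
apply Rplus_le_compat_l, Rmult_le_compat_l; trivial.
rewrite <- Series_scal_l; apply Series_le.
- intros n.
  assert (0 <= (x ^ 2) ^ n) by now apply pow_le.
  split; [apply Rmult_le_pos; [apply Rlt_le, bcoef_pos; lra|easy]|].
  rewrite <- Rmult_assoc; apply Rmult_le_compat_r; trivial.
  rewrite bcoef_succ by trivial.
  apply Rmult_le_compat_r; [now apply Rlt_le, bcoef_pos|].
  apply Rmult_le_compat_l; [lra|].
  assert (0 <= INR n) by apply pos_INR.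
  rewrite S_INR; apply Rinv_le_contravar; lra.
- apply (ex_series_scal_l (K := R_AbsRing) (V := R_NormedModule) (a / (a + 1))
    (fun n => bcoef a (S n) * (x ^ 2) ^ n)).
  now apply ex_series_bcoef_S.
Qed.

Lemma normI_huygens (p x : R) : -1 < p <= 0 ->
  normI (p + 1) x / normI p x
  + (p + 2) * normI p x / (1 + (p + 1) * normI p x) >= 2.
Proof.
intros [Hp Hp0].
assert (Hv := normI_ge_1 p x Hp).
assert (Hy := pow2_ge_0 x).
assert (Lu : 1 + / (4 * (p + 2)) * x ^ 2 <= normI (p + 1) x).
{ rewrite normI_bcoef by lra.
  replace (p + 2) with (p + 1 + 1) by ring; apply Series_bcoef_lower; lra. }
assert (Uv := Series_bcoef_upper (p + 1) (x ^ 2) ltac:(lra) Hy).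
cbv zeta in Uv; rewrite <- normI_bcoef in Uv by trivial.
replace (p + 1 + 1) with (p + 2) in Uv by ring.
set (v := normI p x) in *; set (u := normI (p + 1) x) in *.
set (z := / (4 * (p + 2)) * x ^ 2) in *.
assert (Uv' : (p + 1) * (v - 1) <= (p + 2) * z + (p + 1) * z * (v - 1)).
{ apply (Rmult_le_compat_l (p + 1)) in Uv; [|lra].
  replace ((p + 2) * z + (p + 1) * z * (v - 1))
    with ((p + 1) * (x ^ 2 * (/ (4 * (p + 1)) + / (4 * (p + 2)) * (v - 1))))
    by (unfold z; field; lra).
  trivial. }
assert (Huv : z * (v - 1) <= (u - 1) * (v - 1)) by (apply Rmult_le_compat_r; lra).
(* The sign condition [p <= 0] enters here. *)
assert (Hvv : 0 <= - p * (v - 1) ^ 2)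
  by (apply Rmult_le_pos; [lra|apply pow2_ge_0]).
(* With [U = u - 1] and [V = v - 1] the right side is [(p + 2) U + (p + 1) U V - (p + 1) V - p V ^
   2], which gives the weights [p + 2] and [p + 1] below. *)
assert (Main : 0 <= u * (1 + (p + 1) * v) - v * (2 + p * v)).
{ assert ((p + 1) * (z * (v - 1)) <= (p + 1) * ((u - 1) * (v - 1)))
    by (apply Rmult_le_compat_l; lra).
  assert ((p + 2) * z <= (p + 2) * (u - 1)) by (apply Rmult_le_compat_l; lra).
  lra. }
assert (Hd : 0 < 1 + (p + 1) * v) by nra.
enough (0 <= u / v + (p + 2) * v / (1 + (p + 1) * v) - 2) by lra.
replace (u / v + (p + 2) * v / (1 + (p + 1) * v) - 2)
  with ((u * (1 + (p + 1) * v) - v * (2 + p * v)) / (v * (1 + (p + 1) * v)))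
  by (field; lra).
apply Rmult_le_pos; trivial.
apply Rlt_le, Rinv_0_lt_compat, Rmult_lt_0_compat; lra.
Qed.

(** * The hyperbolic case [p = - 1/2] *)

(** The recurrence divides by [4 (n + 1/2) (n + 1) = (2 n + 1) (2 n + 2)]. *)
Lemma bcoef_half (n : nat) : bcoef (1 / 2) n = / INR (fact (2 * n)).
Proof.
induction n as [|n IH]; [simpl; field|].
replace (2 * S n)%nat with (S (S (2 * n))) by lia.
rewrite bcoef_S, IH, !fact_simpl, !mult_INR, !S_INR, mult_INR.
assert (Hn := pos_INR n).
assert (Hf := INR_fact_lt_0 (2 * n)).
simpl (INR 2); field; repeat split; lra.
Qed.

Lemma bcoef_three_halves (n : nat) :
  bcoef (1 / 2 + 1) n = / INR (fact (2 * n + 1)).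
Proof.
rewrite bcoef_succ, bcoef_half by lra.
replace (2 * n + 1)%nat with (S (2 * n)) by lia.
rewrite fact_simpl, mult_INR, S_INR, mult_INR.
assert (Hn := pos_INR n).
assert (Hf := INR_fact_lt_0 (2 * n)).
simpl (INR 2); field; repeat split; lra.
Qed.

(** The even and odd parts of the exponential series; parity of [normI] then yields [cosh] and
    [sinh]. *)
Lemma exp_normI (x : R) :
  exp x = normI (- (1 / 2)) x + x * normI (- (1 / 2) + 1) x.
Proof.
assert (Hy := pow2_ge_0 x).
assert (E1 : forall a, 0 < a -> ex_series (fun n => bcoef a n * (x ^ 2) ^ n))
  by (intros; now apply ex_series_bcoef).
rewrite exp_Reals, PSeries_odd_even, !normI_bcoef; try lra.
2: { apply ex_pseries_R, ex_series_ext with (2 := E1 (1 / 2) ltac:(lra)).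
     intros n; now rewrite bcoef_half. }
2: { apply ex_pseries_R, ex_series_ext with (2 := E1 (1 / 2 + 1) ltac:(lra)).
     intros n; now rewrite bcoef_three_halves. }
f_equal; [|f_equal]; apply Series_ext; intros n.
- replace (- (1 / 2) + 1) with (1 / 2) by field; now rewrite bcoef_half.
- replace (- (1 / 2) + 1 + 1) with (1 / 2 + 1) by field.
  now rewrite bcoef_three_halves.
Qed.

Lemma normI_opp (q x : R) : normI q (- x) = normI q x.
Proof.
apply Series_ext; intros n; rewrite !pow_mult.
now replace ((- x) ^ 2) with (x ^ 2) by ring.
Qed.

Lemma cosh_normI (x : R) : cosh x = normI (- (1 / 2)) x.
Proof. unfold cosh; rewrite (exp_normI x), (exp_normI (- x)), !normI_opp; field. Qed.

Lemma sinh_normI (x : R) : sinh x = x * normI (- (1 / 2) + 1) x.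
Proof. unfold sinh; rewrite (exp_normI x), (exp_normI (- x)), !normI_opp; field. Qed.

Lemma tanhc_cosh_ge_2 (x : R) : tanhc x + 3 * cosh x / (2 + cosh x) >= 2.
Proof.
assert (Hc : 1 <= cosh x) by (rewrite cosh_normI; apply normI_ge_1; lra).
unfold tanhc; destruct (Req_dec_T x 0) as [-> | Hx].
(* At 0 both summands equal 1, so equality holds. *)
- rewrite cosh_0; right; field.
- assert (H := normI_huygens (- (1 / 2)) x ltac:(lra)).
  rewrite <- cosh_normI in H; unfold tanh; rewrite sinh_normI.
  replace (3 * cosh x / (2 + cosh x))
    with ((- (1 / 2) + 2) * cosh x / (1 + (- (1 / 2) + 1) * cosh x))
    by (field; lra).
  replace (x * normI (- (1 / 2) + 1) x / cosh x / x)
    with (normI (- (1 / 2) + 1) x / cosh x) by (field; lra).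
  exact H.
Qed.

Theorem corollary1 :
  forall p : R, -1 < p <= 0 ->
  forall x : R,
    normI (p + 1) x <= (1 + (p + 1) * normI p x) / (p + 2)
    /\ normI (p + 1) x / normI p x
       + (p + 2) * normI p x / (1 + (p + 1) * normI p x) >= 2
    /\ tanhc x + 3 * cosh x / (2 + cosh x) >= 2.
Proof.
intros p Hp x; split; [|split].
- now apply normI_cusa.
- now apply normI_huygens.
- apply tanhc_cosh_ge_2.
Qed.
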